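(* Let $\Phi\in \mathcal{S}_p^*(Z)$ for some real $p\geq 0$. Then its $p$-variant $\mathrm{Var}_p(\Phi)$ makes sense (i.e. the series defining it converges absolutely), and moreover $$\mathrm{Var}_p(\Phi)\leq \sum_{k=0}^{\infty}\big\|\mathfrak{a}_k^{\dag}\mathfrak{a}_k\Phi\big\|_{-p}^2,$$ where the sum of nonnegative terms on the right-hand side is understood in $[0,\infty]$.
   Context: $\mathbb{N}=\{0,1,2,\dots\}$ and $\Gamma$ is the set of all finite subsets of $\mathbb{N}$; for $\sigma\in\Gamma$, $k\in\mathbb{N}$, write $\sigma\cup k=\sigma\cup\{k\}$, $\sigma\setminus k=\sigma\setminus\{k\}$, and $\mathbf{1}_\sigma$ for the indicator of $\sigma$. $(\Omega,\mathcal{F},P)$ is a probability space with expectation $\mathbb{E}$. A discrete-time normal noise is a sequence $Z=(Z_n)_{n\in\mathbb{N}}$ of integrable (real) random variables on $\Omega$ with $\mathbb{E}[Z_n\mid\mathcal{F}_{n-1}]=0$ and $\mathbb{E}[Z_n^2\mid\mathcal{F}_{n-1}]=1$ for all $n\ge 0$, where $\mathcal{F}_{-1}=\{\emptyset,\Omega\}$ and $\mathcal{F}_n=\sigma(Z_k;0\le k\le n)$. Put $Z_\emptyset=1$ and $Z_\sigma=\prod_{i\in\sigma}Z_i$ for nonempty $\sigma\in\Gamma$; $\{Z_\sigma\mid\sigma\in\Gamma\}$ is an orthonormal system. Let $\mathcal{F}_\infty=\sigma(Z_n;n\in\mathbb{N})$ and let $\mathcal{L}^2(Z)=\mathcal{L}^2(\Omega,\mathcal{F}_\infty,P)$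 (complex-valued functions), with inner product $\langle\cdot,\cdot\rangle$ conjugate-linear in the first and linear in the second argument. $Z$ is a fixed discrete-time normal noise having the chaotic representation property: $\{Z_\sigma\}$ is total in $\mathcal{L}^2(Z)$, hence an orthonormal basis of it. $\lambda_\emptyset=1$ and $\lambda_\sigma=\prod_{k\in\sigma}(k+1)$ for nonempty $\sigma\in\Gamma$. For real $p\ge0$, $\mathcal{S}_p(Z)=\{\xi\in\mathcal{L}^2(Z)\mid\|\xi\|_p^2:=\sum_{\sigma\in\Gamma}\lambda_\sigma^{2p}|\langle Z_\sigma,\xi\rangle|^2<\infty\}$, a Hilbert space. $\mathcal{S}(Z)=\bigcap_{p\ge0}\mathcal{S}_p(Z)$ has the topology generated by the norms $\|\cdot\|_p$, $p\ge 0$; it is dense in each $\mathcal{S}_p(Z)$ and contains every $Z_\sigma$. $\mathcal{S}^*(Z)$ is the dual (continuous linear functionals) of $\mathcal{S}(Z)$ with the strong topology. $\mathcal{S}_p^*(Z)$ is the dual of $\mathcal{S}_p(Z)$ with dual norm $\|\cdot\|_{-p}$, regarded via restriction to $\mathcal{S}(Z)$ as a subspace of $\mathcal{S}^*(Z)$. For $\Phi\in\mathcal{S}^*(Z)$, its Fock transform is the function $\widehat\Phi(\sigma)=\Phi(Z_\sigma)$, $\sigma\in\Gamma$; $\Phi$ is determined by $\widehat\Phi$. Operators: for $k\ge 0$, $\mathfrak{a}_k$, $\mathfrak{a}_k^{\dag}$, $\mathfrak{E}$ are the (continuous linear) operators from $\mathcal{S}^*(Z)$ to itself determined by $\widehat{\mathfrak{a}_k\Phi}(\sigma)=[1-\mathbf{1}_\sigma(k)]\widehat\Phi(\sigma\cup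 k)$, $\widehat{\mathfrak{a}_k^{\dag}\Phi}(\sigma)=\mathbf{1}_\sigma(k)\widehat\Phi(\sigma\setminus k)$, $\widehat{\mathfrak{E}\Phi}(\sigma)=\widehat\Phi(\emptyset)\langle 1,Z_\sigma\rangle$ for all $\sigma\in\Gamma$; $\mathfrak{a}_k$ and $\mathfrak{a}_k^{\dag}$ map each $\mathcal{S}_p^*(Z)$ into itself. For $p\ge0$ and $\Phi,\Psi\in\mathcal{S}^*(Z)$, $\langle\Phi,\Psi\rangle_{-p}=\sum_{\sigma\in\Gamma}\lambda_\sigma^{-2p}\widehat\Phi(\sigma)\overline{\widehat\Psi(\sigma)}$ provided this series converges absolutely. $\mathrm{Cov}_p(\Phi,\Psi)=\langle\Phi-\mathfrak{E}\Phi,\Psi-\mathfrak{E}\Psi\rangle_{-p}$ provided the right-hand side makes sense, and the $p$-variant of $\Phi$ is $\mathrm{Var}_p(\Phi)=\mathrm{Cov}_p(\Phi,\Phi)$. *)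

(* Defs.v *)
From HB Require Import structures.
From mathcomp Require Import all_boot all_order all_algebra.
From mathcomp Require Import finmap.
From mathcomp Require Import complex.
From mathcomp Require Import all_classical all_reals all_analysis.
From mathcomp Require Import measurable_realfun summability.
From mathcomp Require Import ring lra.
Set Implicit Arguments.
Unset Strict Implicit.
Unset Printing Implicit Defensive.
Import Order.TTheory GRing.Theory Num.Theory.
Import numFieldNormedType.Exports.
Import ComplexField.Normc.
Local Open Scope classical_set_scope.
Local Open Scope ring_scope.

Notation Gamma := {fset nat}.

Section noise.
Context {R : realType} {d : measure_display} {T : measurableType d}.
Variable P : probability T R.

Definition sub_measurable (G : set_system T) (X : T -> R) : Prop :=
  preimage_set_system setT X measurable `<=` G.

(* [Y] is a version of the conditional expectation of [X] given the
   sigma-algebra [G]. *)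
Definition cond_expectation (G : set_system T) (X Y : T -> R) : Prop :=
  [/\ P.-integrable setT (EFin \o X),
      P.-integrable setT (EFin \o Y),
      sub_measurable G Y &
      forall A, G A ->
        (\int[P]_(w in A) (X w)%:E = \int[P]_(w in A) (Y w)%:E)%E].

(* sigma(Z_k, k < n); for [n = 0] the generating family is empty and this is
   the trivial sigma-algebra. *)
Definition noise_past (Z : nat -> {RV P >-> R}) (n : nat) : set_system T :=
  <<s \bigcup_(k in [set k | (k < n)%N])
        preimage_set_system setT (Z k) measurable >>.

Definition noise_total (Z : nat -> {RV P >-> R}) : set_system T :=
  <<s \bigcup_k preimage_set_system setT (Z k) measurable >>.

Record normal_noise := NormalNoise {
  noise :> nat -> {RV P >-> R};
  noise_integrable : forall n, P.-integrable setT (EFin \o noise n);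
  noise_mean : forall n,
    cond_expectation (noise_past noise n) (noise n) (cst 0);
  noise_variance : forall n,
    cond_expectation (noise_past noise n) (fun w => noise n w ^+ 2) (cst 1) }.

Definition inner (f g : T -> R[i]^o) : R[i] :=
  ((\int[P]_w complex.Re ((f w)^* * g w))
    +i* (\int[P]_w complex.Im ((f w)^* * g w)))%C.

Variable Z : normal_noise.

(* Elements of L^2 are represented by functions, not by classes modulo almost
   sure equality. Functions that are almost surely equal have the same inner
   products, hence are at distance 0 for all the seminorms below; a continuous
   linear functional takes the same value on them, so the dual spaces are the
   same as for the spaces of classes. *)
Definition L2Z : set (T -> R[i]^o) :=
  [set f | [/\ sub_measurable (noise_total Z) (fun w => complex.Re (f w)),
      sub_measurable (noise_total Z) (fun w => complex.Im (f w)) &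
      (\int[P]_w (normc (f w) ^+ 2)%:E < +oo)%E]].

Definition Zprod (s : Gamma) : T -> R[i]^o :=
  fun w => (\prod_(i <- s) Z i w)%:C%C.

(* The linear span of the [Zprod s] is dense in L^2(Z). *)
Definition chaotic_representation : Prop :=
  forall f, L2Z f -> forall e : R, 0 < e ->
  exists (F : {fset Gamma}) (c : Gamma -> R[i]),
    (\int[P]_w (normc (f w - \sum_(s <- F) c s * Zprod s w) ^+ 2)%:E
       < (e ^+ 2)%:E)%E.

Definition lambda (s : Gamma) : R := \prod_(k <- s) (k.+1)%:R.

Definition normp2 (p : R) (f : T -> R[i]^o) : \bar R :=
  (\esum_(s in [set: Gamma])
     (lambda s `^ (2 * p) * normc (inner (Zprod s) f) ^+ 2)%:E)%E.

End noise.

Section pull.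
Context {R : realType} {d : measure_display} {T : measurableType d}.
Variables (P : probability T R) (F : set (set T)).
Hypothesis sF : F `<=` measurable.
Notation T' := (g_sigma_algebraType F).
Import HBNNSimple.

Lemma gen_measurable : <<s F >> `<=` (measurable : set (set T)).
Proof. exact: smallest_sub (sigma_algebra_measurable T) sF. Qed.

Lemma gen_measurable_fun (X : T -> R) :
  measurable_fun setT (X : T' -> R) -> measurable_fun setT X.
Proof. by move=> mX _ B mB; apply: gen_measurable; exact: mX. Qed.

Lemma pull_ge0 (g h : T -> R) (X : T -> R) :
  measurable_fun setT g -> (forall w, 0 <= g w) ->
  measurable_fun setT h -> (forall w, 0 <= h w) ->
  measurable_fun setT (X : T' -> R) -> (forall w, 0 <= X w) ->
  (forall A, <<s F >> A ->
     \int[P]_(w in A) (g w)%:E = \int[P]_(w in A) (h w)%:E)%E ->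
  (\int[P]_w (X w * g w)%:E = \int[P]_w (X w * h w)%:E)%E.
Proof.
move=> mg g0 mh h0 mX X0 gh.
have mX' : @measurable_fun _ _ T' (\bar R) setT (EFin \o X) by exact/measurable_EFinP.
pose f_ := nnsfun_approx (@measurableT _ T') mX'.
have mset n (B : set R) : measurable B -> <<s F >> (f_ n @^-1` B).
  move=> mB; have := @measurable_funPT _ _ _ _ (f_ n) measurableT _ mB.
  by rewrite setTI.
have mf n : measurable_fun setT (f_ n : T -> R).
  by apply: gen_measurable_fun => _ B mB; rewrite setTI; exact: mset.
have key n (u : T -> R) : measurable_fun setT u -> (forall w, 0 <= u w) ->
   (\int[P]_w (f_ n w * u w)%:E = \sum_(y \in range (f_ n))
      (y%:E * \int[P]_(w in f_ n @^-1` [set y]) (u w)%:E))%E.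
  move=> mu u0.
  transitivity (\int[P]_w (\sum_(y \in range (f_ n))
     (y * \1_(f_ n @^-1` [set y]) w * u w)%:E))%E.
    apply: eq_integral => w _; rewrite fsumEFin// (fimfunE (f_ n)).
    by congr EFin; rewrite !fsbig_finite// big_distrl.
  have yms y : measurable (f_ n @^-1` [set y] : set T).
    by apply: gen_measurable; exact: mset.
  have mm y : measurable_fun setT (fun w : T => (y * \1_(f_ n @^-1` [set y]) w * u w)%:E).
    apply/measurable_EFinP; apply: measurable_funM => //.
    apply: measurable_funM => //.
  have yind y w : 0 <= y * \1_(f_ n @^-1` [set y]) w.
    rewrite indicE; case: (boolP (w \in _)) => [|_]; last by rewrite mulr0.
    by rewrite inE /= => <-; rewrite mulr1.
  rewrite ge0_integral_fsum//; last first.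
    by move=> y w _; rewrite lee_fin mulr_ge0.
  apply: eq_fsbigr => y /set_mem[w0 _ <-].
  set A := _ @^-1` _.
  rewrite [in RHS]integral_mkcond -ge0_integralZl//; last 3 first.
  - apply/(measurable_restrictT _ _).1 => //.
      exact: yms.
    by apply/measurable_EFinP; exact: measurable_funTS.
  - move=> w _; rewrite /patch; case: ifP => _ //; by rewrite lee_fin.
  - by rewrite lee_fin.
  apply: eq_integral => w _; rewrite /patch indicE.
  by case: ifP => _; rewrite ?mulr1 ?mulr0 ?mul0r ?mule0// EFinM.
have lim (u : T -> R) : measurable_fun setT u -> (forall w, 0 <= u w) ->
   (\int[P]_w (X w * u w)%:E = limn (fun n => \int[P]_w (f_ n w * u w)%:E))%E.
  move=> mu u0.
  rewrite -monotone_convergence//.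
  - apply: eq_integral => w _; apply/esym/cvg_lim => //.
    under eq_fun do rewrite EFinM.
    rewrite EFinM; apply: cvgeZr => //.
    by apply: cvg_nnsfun_approx => // y _; rewrite lee_fin.
  - by move=> n; apply/measurable_EFinP; exact: measurable_funM.
  - by move=> n w _; rewrite lee_fin mulr_ge0.
  - move=> w _ m n mn; rewrite lee_fin ler_wpM2r//.
    by have /lefP := nd_nnsfun_approx (@measurableT _ T') mX' mn; apply.
rewrite !lim//; congr (limn _); apply/funext => n.
rewrite !key//; apply: eq_fsbigr => y _; congr (_ * _)%E.
by apply: gh; exact: mset.
Qed.

Lemma pull (g h : T -> R) (X : T -> R) :
  measurable_fun setT g -> (forall w, 0 <= g w) ->
  measurable_fun setT h -> (forall w, 0 <= h w) ->
  measurable_fun setT (X : T' -> R) ->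
  (forall A, <<s F >> A ->
     \int[P]_(w in A) (g w)%:E = \int[P]_(w in A) (h w)%:E)%E ->
  (\int[P]_w (X w * g w)%:E = \int[P]_w (X w * h w)%:E)%E.
Proof.
move=> mg g0 mh h0 mX gh.
have pos (u : T -> R) : (forall w, 0 <= u w) ->
    (\int[P]_w (X w * u w)%:E = \int[P]_w (Num.max (X w) 0 * u w)%:E
      - \int[P]_w (Num.max (- X w) 0 * u w)%:E)%E.
  move=> u0; rewrite integralE; congr (_ - _)%E; apply: eq_integral => w _.
    by rewrite funeposE -EFin_max; congr EFin; rewrite maxr_pMl// mul0r.
  by rewrite funenegE -EFinN -EFin_max; congr EFin; rewrite maxr_pMl// mul0r mulNr.
rewrite !pos//; congr (_ - _)%E; apply: pull_ge0 => //.
- exact: measurable_maxr.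
- by move=> w; rewrite le_max lexx orbT.
- by apply: measurable_maxr => //; exact: measurableT_comp.
- by move=> w; rewrite le_max lexx orbT.
Qed.

Lemma pull0 (u : T -> R) (X : T -> R) :
  P.-integrable setT (EFin \o u) ->
  measurable_fun setT (X : T' -> R) ->
  P.-integrable setT (fun w => (X w * u w)%:E) ->
  (forall A, <<s F >> A -> \int[P]_(w in A) (u w)%:E = 0)%E ->
  (\int[P]_w (X w * u w)%:E = 0)%E.
Proof.
move=> iu mX iXu u0.
have mu : measurable_fun setT u by apply/measurable_EFinP; exact: measurable_int iu.
have mX1 := gen_measurable_fun mX.
pose g w := Num.max (u w) 0; pose h w := Num.max (- u w) 0.
have g0 w : 0 <= g w by rewrite le_max lexx orbT.
have h0 w : 0 <= h w by rewrite le_max lexx orbT.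
have mg : measurable_fun setT g by exact: measurable_maxr.
have mh : measurable_fun setT h.
  by apply: measurable_maxr => //; exact: measurableT_comp.
have ugh w : u w = g w - h w.
  rewrite /g /h; case: (lerP (u w) 0) => hu.
    by rewrite max_l ?opprK ?add0r// oppr_ge0.
  by rewrite max_r ?subr0// oppr_le0 ltW.
have gu w : `|g w| <= `|u w|.
  rewrite /g; case: (lerP (u w) 0) => //.
  by rewrite normr0.
have hu w : `|h w| <= `|u w|.
  rewrite /h; case: (lerP (- u w) 0) => //; first by rewrite normr0.
  by rewrite normrN.
have ig : P.-integrable setT (EFin \o g).
  apply: le_integrable iu => //; first exact/measurable_EFinP.
  by move=> w _; rewrite /= lee_fin.
have ih : P.-integrable setT (EFin \o h).
  apply: le_integrable iu => //; first exact/measurable_EFinP.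
  by move=> w _; rewrite /= lee_fin.
have iXg : P.-integrable setT (EFin \o (fun w => X w * g w)).
  apply: le_integrable iXu => //.
    by apply/measurable_EFinP; exact: measurable_funM.
  by move=> w _; rewrite /= lee_fin !normrM ler_wpM2l.
have iXh : P.-integrable setT (EFin \o (fun w => X w * h w)).
  apply: le_integrable iXu => //.
    by apply/measurable_EFinP; exact: measurable_funM.
  by move=> w _; rewrite /= lee_fin !normrM ler_wpM2l.
under eq_integral do rewrite ugh mulrBr EFinB.
rewrite integralB_EFin//.
rewrite (@pull g h)// ?subee//.
  exact: integrable_fin_num.
move=> A FA; have mA := gen_measurable FA.
have igA := integrableS measurableT mA (@subsetT _ A) ig.
have ihA := integrableS measurableT mA (@subsetT _ A) ih.
have := u0 A FA; under eq_integral do rewrite ugh EFinB.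
rewrite integralB_EFin//.
have -> : (\int[P]_(w in A) (g w)%:E = (fine (\int[P]_(w in A) (g w)%:E))%:E)%E.
  by rewrite fineK//; exact: (integrable_fin_num mA igA).
have -> : (\int[P]_(w in A) (h w)%:E = (fine (\int[P]_(w in A) (h w)%:E))%:E)%E.
  by rewrite fineK//; exact: (integrable_fin_num mA ihA).
by rewrite -EFinB => -[] /eqP; rewrite subr_eq0 => /eqP ->.
Qed.

End pull.

Section ortho.
Context {R : realType} {d : measure_display} {T : measurableType d}.
Context {P : probability T R} (Z : normal_noise P).

Definition Zr (s : Gamma) (w : T) : R := \prod_(i <- s) Z i w.

Lemma Zr0 : Zr fset0 = cst 1.
Proof. by apply/funext => w; rewrite /Zr big_seq_fset0. Qed.

Lemma ZrU n s w : n \notin s -> Zr (n |` s)%fset w = Z n w * Zr s w.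
Proof. by move=> ns; rewrite /Zr big_fsetU1. Qed.

Notation gen n := (\bigcup_(k in [set k | (k < n)%N])
        preimage_set_system setT (Z k) measurable).

Lemma gen_sub n : gen n `<=` (measurable : set (set T)).
Proof. by move=> _ [k _ [B mB <-]]; exact: measurable_funPT. Qed.

Lemma gent_sub : \bigcup_k preimage_set_system setT (Z k) measurable `<=` (measurable : set (set T)).
Proof. by move=> _ [k _ [B mB <-]]; exact: measurable_funPT. Qed.

Lemma Zr_past s n : (forall i, i \in s -> (i < n)%N) ->
  measurable_fun setT (Zr s : g_sigma_algebraType (gen n) -> R).
Proof.
move=> sn; apply: measurable_prod => i /sn ni _ B mB.
by apply: sub_sigma_algebra; exists i => //; exists B.
Qed.

Lemma Zr_total s : sub_measurable (noise_total Z) (Zr s).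
Proof.
move=> _ [B mB <-].
have : measurable_fun setT (Zr s : g_sigma_algebraType
  (\bigcup_k preimage_set_system setT (Z k) measurable) -> R).
  apply: measurable_prod => i _ _ C mC.
  by apply: sub_sigma_algebra; exists i => //; exists C.
by move=> /(_ measurableT B mB).
Qed.

Lemma measurable_Zr s : measurable_fun setT (Zr s).
Proof. by apply: measurable_prod => i _; exact: measurable_funPT. Qed.

Lemma Zr_bound (s : Gamma) : exists n, forall i, i \in s -> (i < n)%N.
Proof.
exists (\max_(i <- s) i).+1 => i si.
by rewrite ltnS; exact: leq_bigmax_seq.
Qed.

Lemma fset_split n (s : Gamma) : (forall i, i \in s -> (i < n.+1)%N) ->
  n \notin s -> forall i, i \in s -> (i < n)%N.
Proof.
move=> sn ns i si; have := sn i si; rewrite ltnS leq_eqVlt => /orP[/eqP ein|//].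
by rewrite -ein si in ns.
Qed.

Lemma fset_splitD n (s : Gamma) : (forall i, i \in s -> (i < n.+1)%N) ->
  forall i, i \in (s `\ n)%fset -> (i < n)%N.
Proof.
move=> sn; apply: fset_split; last by rewrite !inE eqxx.
by move=> i; rewrite !inE => /andP[_ /sn].
Qed.

Lemma ZrD n s w : n \in s -> Zr s w = Z n w * Zr (s `\ n)%fset w.
Proof. by move=> ns; rewrite -{1}(fsetD1K ns) ZrU// !inE eqxx. Qed.

Lemma pull2 n X : measurable_fun setT (X : g_sigma_algebraType (gen n) -> R) ->
  (\int[P]_w (X w * Z n w ^+ 2)%:E = \int[P]_w (X w)%:E)%E.
Proof.
move=> mX; have [_ _ _ vZ] := noise_variance Z n.
rewrite (@pull _ _ _ P (gen n) (@gen_sub n) _ (cst 1) X)//.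
- by apply: eq_integral => w _; rewrite mulr1.
- exact: measurable_funX.
- by move=> w; exact: sqr_ge0.
Qed.

Lemma Zr2 s : (\int[P]_w (Zr s w ^+ 2)%:E = 1)%E.
Proof.
have [n] := Zr_bound s; elim: n s => [|n IH] s sn.
  have -> : s = fset0 by apply/fsetP => i; rewrite inE; apply/negP => /sn.
  rewrite Zr0; under eq_integral do rewrite /= expr1n.
  by rewrite integral_cst// mul1e; exact: probability_setT.
have [ns|ns] := boolP (n \in s); last by apply: IH; exact: fset_split.
under eq_integral do rewrite (ZrD _ ns) exprMn mulrC.
rewrite (pull2 (X := fun w => Zr (s `\ n)%fset w ^+ 2)).
  by apply: IH; exact: fset_splitD.
apply: (measurable_funX (T := g_sigma_algebraType (gen n))).
by apply: Zr_past; exact: fset_splitD.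
Qed.

Lemma integrable_sq (f : T -> R) : measurable_fun setT f ->
  (\int[P]_w (f w ^+ 2)%:E < +oo)%E ->
  P.-integrable setT (fun w => (f w ^+ 2)%:E).
Proof.
move=> mf f2; apply/integrableP; split.
  by apply/measurable_EFinP; exact: measurable_funX.
by under eq_integral do rewrite /= ger0_norm ?sqr_ge0//.
Qed.

Lemma integrable_mul (f g : T -> R) :
  measurable_fun setT f -> measurable_fun setT g ->
  (\int[P]_w (f w ^+ 2)%:E < +oo)%E -> (\int[P]_w (g w ^+ 2)%:E < +oo)%E ->
  P.-integrable setT (EFin \o (fun w => f w * g w)).
Proof.
move=> mf mg /(integrable_sq mf) f2 /(integrable_sq mg) g2.
apply: le_integrable (integrableD measurableT f2 g2) => //.
  by apply/measurable_EFinP; exact: measurable_funM.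
move=> w _; rewrite /= lee_fin -?EFinD /=.
rewrite [leRHS]ger0_norm ?addr_ge0 ?sqr_ge0// normrM.
have := sqr_ge0 (`|f w| - `|g w|).
rewrite -[f w ^+ 2]real_normK ?num_real// -[g w ^+ 2]real_normK ?num_real//.
have := sqr_ge0 (`|f w|); have := sqr_ge0 (`|g w|).
nra.
Qed.

Lemma integrable_Zr2 s t : P.-integrable setT (EFin \o (fun w => Zr s w * Zr t w)).
Proof.
by apply: integrable_mul; rewrite ?Zr2 ?ltry//; exact: measurable_Zr.
Qed.

Lemma Zr_past2 n s t :
  (forall i, i \in s -> (i < n)%N) -> (forall i, i \in t -> (i < n)%N) ->
  measurable_fun setT ((fun w => Zr s w * Zr t w) : g_sigma_algebraType (gen n) -> R).
Proof.
move=> sn tn; apply: (measurable_funM (T := g_sigma_algebraType (gen n))); exact: Zr_past.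
Qed.

Lemma Zr_ortho_aux n s t : n \in s -> n \notin t ->
  (forall i, i \in s -> (i < n.+1)%N) -> (forall i, i \in t -> (i < n.+1)%N) ->
  (\int[P]_w (Zr s w * Zr t w)%:E = 0)%E.
Proof.
move=> ns nt sn tn; have [_ _ _ mZ] := noise_mean Z n.
under eq_integral do rewrite (ZrD _ ns) -mulrA mulrC.
apply: (@pull0 _ _ _ P (gen n) (@gen_sub n) (Z n)
  (fun w => Zr (s `\ n)%fset w * Zr t w)).
- exact: noise_integrable.
- by apply: Zr_past2; [exact: fset_splitD|exact: fset_split].
- have := integrable_Zr2 s t; congr (P.-integrable _ _).
  by apply/funext => w /=; rewrite (ZrD _ ns) -mulrA mulrC.
- by move=> A /mZ ->; rewrite integral0.
Qed.

Lemma Zr_ortho s t : s != t -> (\int[P]_w (Zr s w * Zr t w)%:E = 0)%E.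
Proof.
have [n] := Zr_bound (s `|` t)%fset => stn.
have : forall i, i \in t -> (i < n)%N by move=> i ti; apply: stn; rewrite inE ti orbT.
have : forall i, i \in s -> (i < n)%N by move=> i ti; apply: stn; rewrite inE ti.
move=> {stn}; elim: n s t => [|n IH] s t sn tn st.
  have s0 : s = fset0 by apply/fsetP => i; rewrite inE; apply/negP => /sn.
  have t0 : t = fset0 by apply/fsetP => i; rewrite inE; apply/negP => /tn.
  by rewrite s0 t0 eqxx in st.
have [ns|ns] := boolP (n \in s); have [nt|nt] := boolP (n \in t).
- under eq_integral do rewrite (ZrD _ ns) (ZrD _ nt) mulrACA -expr2 mulrC.
  rewrite (pull2 (X := fun w => Zr (s `\ n)%fset w * Zr (t `\ n)%fset w)).
    apply: IH; [exact: fset_splitD|exact: fset_splitD|].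
    by apply: contra st => /eqP e; rewrite -(fsetD1K ns) e fsetD1K.
  by apply: Zr_past2; exact: fset_splitD.
- exact: Zr_ortho_aux ns nt sn tn.
- under eq_integral do rewrite mulrC.
  exact: Zr_ortho_aux nt ns tn sn.
- by apply: IH => //; exact: fset_split.
Qed.
End ortho.

Section closed.
Context {R : realType} {d : measure_display} {T : measurableType d}.
Context {P : probability T R} (Z : normal_noise P).

Lemma linE a (f g : T -> R[i]^o) w : (a *: f + g) w = (a : R[i]) * f w + g w.
Proof. by []. Qed.

Lemma normc2 (z : R[i]) : normc z ^+ 2 = complex.Re z ^+ 2 + complex.Im z ^+ 2.
Proof. by case: z => a b; rewrite /normc sqr_sqrtr// addr_ge0 ?sqr_ge0. Qed.

Lemma normc2_le (a x y : R[i]) :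
  normc (a * x + y) ^+ 2 <= 2 * normc a ^+ 2 * normc x ^+ 2 + 2 * normc y ^+ 2.
Proof.
rewrite -mulrA -exprMn -normcM.
move: (a * x) => {a x} x; rewrite !normc2; case: x y => [a b] [c e] /=.
have := sqr_ge0 (a - c); have := sqr_ge0 (b - e); nra.
Qed.

Notation Tt := (g_sigma_algebraType (\bigcup_k preimage_set_system setT (Z k) measurable)).

Lemma sub_measurableP (X : T -> R) :
  sub_measurable (noise_total Z) X <-> measurable_fun setT (X : Tt -> R).
Proof.
split=> [mX _ B mB|mX _ [B mB <-]]; last exact: mX.
by apply: mX; exists B.
Qed.

Lemma L2_measurable f : L2Z Z f ->
  measurable_fun setT (fun w => complex.Re (f w)) /\
  measurable_fun setT (fun w => complex.Im (f w)).
Proof.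
by move=> [/sub_measurableP mr /sub_measurableP mi _]; split;
  apply: (gen_measurable_fun (@gent_sub _ _ _ _ Z)).
Qed.

Lemma L2_lty f : L2Z Z f ->
  (\int[P]_w (complex.Re (f w) ^+ 2)%:E < +oo)%E /\
  (\int[P]_w (complex.Im (f w) ^+ 2)%:E < +oo)%E.
Proof.
move=> Lf; have [mr mi] := L2_measurable Lf; have [_ _ f2] := Lf.
have mn : measurable_fun setT (fun w => (normc (f w) ^+ 2)%:E).
  under eq_fun do rewrite normc2; apply/measurable_EFinP.
  by apply: measurable_funD; exact: measurable_funX.
split; apply: le_lt_trans f2; apply: ge0_le_integral => //.
- by move=> w _; rewrite lee_fin sqr_ge0.
- by apply/measurable_EFinP; exact: measurable_funX.
- by move=> w _; rewrite lee_fin normc2 lerDl sqr_ge0.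
- by move=> w _; rewrite lee_fin sqr_ge0.
- by apply/measurable_EFinP; exact: measurable_funX.
- by move=> w _; rewrite lee_fin normc2 lerDr sqr_ge0.
Qed.

Lemma inner_Zprod s f : inner P (Zprod Z s) f =
  ((\int[P]_w (Zr Z s w * complex.Re (f w)))
    +i* (\int[P]_w (Zr Z s w * complex.Im (f w))))%C.
Proof.
congr Complex; apply: eq_Rintegral => w _; rewrite /Zprod;
  by case: (f w) => a b /=; rewrite oppr0 ?mul0r ?subr0 ?addr0.
Qed.

Lemma Zr_integrable s f : L2Z Z f ->
  P.-integrable setT (EFin \o (fun w => Zr Z s w * complex.Re (f w))) /\
  P.-integrable setT (EFin \o (fun w => Zr Z s w * complex.Im (f w))).
Proof.
move=> Lf; have [mr mi] := L2_measurable Lf; have [lr li] := L2_lty Lf.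
by split; apply: integrable_mul => //; rewrite ?Zr2 ?ltry//; exact: measurable_Zr.
Qed.

Lemma inner_linear s a f g : L2Z Z f -> L2Z Z g ->
  inner P (Zprod Z s) (a *: f + g) =
  a * inner P (Zprod Z s) f + inner P (Zprod Z s) g.
Proof.
move=> Lf Lg; rewrite !inner_Zprod.
have [fr fi] := Zr_integrable s Lf; have [gr gi] := Zr_integrable s Lg.
have iZ c h : P.-integrable setT (EFin \o h) ->
  P.-integrable setT (EFin \o (fun w => c * h w)).
  by move=> ih; have := integrableZl measurableT c ih.
case: a => a b /=; congr Complex.
- rewrite -!RintegralZl// -RintegralB//; try exact: iZ.
  rewrite -RintegralD//; last first.
    by have := integrableB measurableT (iZ a _ fr) (iZ b _ fi).
  apply: eq_Rintegral => w _ /=.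
  by rewrite linE; case: (f w) (g w) => [x y] [x' y'] /=; ring.
- rewrite -!RintegralZl// -RintegralD//; try exact: iZ.
  rewrite -RintegralD//; last first.
    by have := integrableD measurableT (iZ a _ fi) (iZ b _ fr).
  apply: eq_Rintegral => w _ /=.
  by rewrite linE; case: (f w) (g w) => [x y] [x' y'] /=; ring.
Qed.

Lemma L2Z_linear a f g : L2Z Z f -> L2Z Z g -> L2Z Z (a *: f + g).
Proof.
move=> Lf Lg; have [mfr mfi] := L2_measurable Lf.
have [mgr mgi] := L2_measurable Lg.
case: (Lf) (Lg) => [/sub_measurableP fr /sub_measurableP fi f2]
  [/sub_measurableP gr /sub_measurableP gi g2].
have mn h : L2Z Z h -> measurable_fun setT (fun w => (normc (h w) ^+ 2)%:E).
  move=> /L2_measurable[? ?]; under eq_fun do rewrite normc2; apply/measurable_EFinP.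
  by apply: measurable_funD; exact: measurable_funX.
have mre : sub_measurable (noise_total Z) (fun w => complex.Re ((a *: f + g) w)).
  apply/sub_measurableP.
  have -> : (fun w => complex.Re ((a *: f + g) w)) = (fun w => complex.Re a * complex.Re (f w) -
     complex.Im a * complex.Im (f w) + complex.Re (g w)).
    by apply/funext => w; rewrite linE; clear; case: a (f w) (g w) => [? ?] [? ?] [? ?].
  apply: (measurable_funD (T := Tt)) => //.
  by apply: (measurable_funB (T := Tt)) => //; exact: (measurable_funM (T := Tt)).
have mim : sub_measurable (noise_total Z) (fun w => complex.Im ((a *: f + g) w)).
  apply/sub_measurableP.
  have -> : (fun w => complex.Im ((a *: f + g) w)) = (fun w => complex.Re a * complex.Im (f w) +
     complex.Im a * complex.Re (f w) + complex.Im (g w)).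
    by apply/funext => w; rewrite linE; clear; case: a (f w) (g w) => [? ?] [? ?] [? ?].
  apply: (measurable_funD (T := Tt)) => //.
  by apply: (measurable_funD (T := Tt)) => //; exact: (measurable_funM (T := Tt)).
split => //.
pose c := 2 * normc a ^+ 2.
have c0 : 0 <= c by rewrite mulr_ge0// sqr_ge0.
have mcf : measurable_fun setT (fun w => c%:E * (normc (f w) ^+ 2)%:E)%E.
  by apply: emeasurable_funM => //; exact: mn.
have m2g : measurable_fun setT (fun w => 2%:E * (normc (g w) ^+ 2)%:E)%E.
  by apply: emeasurable_funM => //; exact: mn.
apply: (@le_lt_trans _ _ (\int[P]_w (c%:E * (normc (f w) ^+ 2)%:E + 2%:E * (normc (g w) ^+ 2)%:E))%E).
  apply: ge0_le_integral => //.
  - by move=> w _; rewrite lee_fin sqr_ge0.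
  - under eq_fun do rewrite normc2; apply/measurable_EFinP.
    by apply: measurable_funD; apply: measurable_funX;
      apply: (gen_measurable_fun (@gent_sub _ _ _ _ Z)); exact/sub_measurableP.
  - exact: emeasurable_funD.
  - by move=> w _; rewrite -!EFinM -EFinD lee_fin linE normc2_le.
rewrite ge0_integralD//; last 2 first.
- by move=> w _; rewrite -EFinM lee_fin mulr_ge0// sqr_ge0.
- by move=> w _; rewrite -EFinM lee_fin mulr_ge0// sqr_ge0.
have sq h w : (0 <= (normc (h w : R[i]) ^+ 2)%:E)%E by rewrite lee_fin sqr_ge0.
rewrite !ge0_integralZl//; try exact: mn.
by rewrite lte_add_pinfty// lte_mul_pinfty.
Qed.

Lemma normp2_lty p a (f g : T -> R[i]^o) : L2Z Z f -> L2Z Z g ->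
  (normp2 Z p f < +oo)%E -> (normp2 Z p g < +oo)%E ->
  (normp2 Z p (a *: f + g)%R < +oo)%E.
Proof.
move=> Lf Lg f2 g2; pose c := 2 * normc a ^+ 2.
have c0 : 0 <= c by rewrite mulr_ge0// sqr_ge0.
have t0 (h : T -> R[i]^o) s : (0 <= (lambda s `^ (2 * p) * normc (inner P (Zprod Z s) h) ^+ 2)%:E)%E.
  by rewrite lee_fin mulr_ge0 ?powR_ge0 ?sqr_ge0.
have esumZ (e : R) (h : T -> R[i]^o) : 0 <= e -> (normp2 Z p h < +oo)%E ->
    (\esum_(s in [set: Gamma]) (e%:E *
      (lambda s `^ (2 * p) * normc (inner P (Zprod Z s) h) ^+ 2)%:E) < +oo)%E.
  move=> e0 h2.
  apply: (@le_lt_trans _ _ (e%:E * normp2 Z p h)%E); last by rewrite lte_mul_pinfty ?lee_fin.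
  apply: ge_ereal_sup => _ [A [fA _] <-].
  rewrite -ge0_mule_fsumr// lee_wpmul2l ?lee_fin//.
  by apply: ereal_sup_ubound; exists A.
apply: (@le_lt_trans _ _ (\esum_(s in [set: Gamma]) (c%:E *
      (lambda s `^ (2 * p) * normc (inner P (Zprod Z s) f) ^+ 2)%:E + 2%:E *
      (lambda s `^ (2 * p) * normc (inner P (Zprod Z s) g) ^+ 2)%:E))%E).
  apply: le_esum => s _; rewrite inner_linear// -!EFinM -EFinD lee_fin.
  rewrite (mulrCA c) (mulrCA 2) -mulrDr; apply: ler_wpM2l; first exact: powR_ge0.
  exact: normc2_le.
rewrite esumD; last 2 first.
- by move=> s _; rewrite mule_ge0.
- by move=> s _; rewrite mule_ge0.
by rewrite lte_add_pinfty// esumZ.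
Qed.

Lemma L2Z0 : L2Z Z 0.
Proof.
split; rewrite /=.
- by apply/sub_measurableP; exact: (@measurable_cst _ _ Tt _ setT (0 : R)).
- by apply/sub_measurableP; exact: (@measurable_cst _ _ Tt _ setT (0 : R)).
- rewrite (eq_integral (cst 0%E)) ?integral0 ?ltry// => w _.
  by rewrite /= expr0n addr0 sqrtr0 expr0n.
Qed.

Lemma Rint0 : \int[P]_w (0 : R) = 0.
Proof. by rewrite /Rintegral integral0. Qed.

Lemma normp20 p : normp2 Z p 0 = 0%E.
Proof.
rewrite /normp2 esum1// => s _.
have -> : inner P (Zprod Z s) 0 = 0.
  by rewrite inner_Zprod; congr Complex;
    (under eq_Rintegral do rewrite mulr0); exact: Rint0.
by rewrite normc0 expr0n mulr0.
Qed.

Lemma inner_ZZ s t : inner P (Zprod Z s) (Zprod Z t) = (s == t)%:R.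
Proof.
rewrite inner_Zprod.
have -> : \int[P]_w (Zr Z s w * complex.Im (Zprod Z t w)) = 0.
  by under eq_Rintegral do rewrite mulr0; exact: Rint0.
rewrite /Rintegral /=; have [<-|st] := eqVneq s t; last by rewrite (Zr_ortho Z st).
by under eq_integral do rewrite -expr2; rewrite Zr2.
Qed.

Lemma L2Z_Zprod s : L2Z Z (Zprod Z s).
Proof.
split; first exact: Zr_total.
- by apply/sub_measurableP; exact: (@measurable_cst _ _ Tt _ setT (0 : R)).
- by under eq_integral do rewrite normc2 /= expr0n addr0; rewrite Zr2 ltry.
Qed.

Lemma normp2_Zprod p s : (normp2 Z p (Zprod Z s) < +oo)%E.
Proof.
rewrite /normp2; apply: (@le_lt_trans _ _ (\esum_(t in [set: Gamma])
  (if t \in [set s] then (lambda t `^ (2 * p))%:E else 0))%E).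
  apply: le_esum => t _; rewrite inner_ZZ; case: eqVneq => [->|ts].
    by rewrite mem_set// normc1 expr1n mulr1.
  by rewrite normc0 expr0n mulr0; case: ifP => //; rewrite lee_fin powR_ge0.
by rewrite -esum_mkcond esum_set1 ?ltry// lee_fin powR_ge0.
Qed.
End closed.

Section spaces.
Context {R : realType} {d : measure_display} {T : measurableType d}.
Context {P : probability T R}.
Variable Z : normal_noise P.

(* The intersection of the spaces S_p(Z) over [p] in [A], with the topology
   generated by the norms ||.||_p for [p] in [A]. Thus [Sspace [set p]] is
   S_p(Z), and [Sspace [set p | 0 <= p]] is S(Z). *)
Definition Spred (A : set R) : {pred T -> R[i]^o} :=
  mem [set f | L2Z Z f /\ forall p, A p -> (normp2 Z p f < +oo)%E].

Lemma Spred_submod_closed A : submod_closed (Spred A).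
Proof.
split; first by rewrite inE /=; split=> [|p _]; [exact: L2Z0|rewrite normp20 ltry].
move=> a f g; rewrite !inE /= => -[Lf f2] [Lg g2]; split=> [|p Ap].
  exact: L2Z_linear.
by apply: normp2_lty => //; [exact: f2|exact: g2].
Qed.

HB.instance Definition _ A := GRing.isSubmodClosed.Build R[i]
  (T -> R[i]^o) (Spred A) (Spred_submod_closed A).

Record Sspace (A : set R) := SSpace {
  Sval :> T -> R[i]^o; _ : Sval \in Spred A }.

HB.instance Definition _ A := [isSub for @Sval A].
HB.instance Definition _ A := [Choice of Sspace A by <:].
HB.instance Definition _ A := [SubChoice_isSubLmodule of Sspace A by <:].

Definition Sball (A : set R) (i : (R * R) * Sspace A) : set (Sspace A) :=
  [set f | (normp2 Z i.1.1 (f - i.2)%R < (i.1.2 ^+ 2)%:E)%E].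

HB.instance Definition _ A := isPointed.Build (Sspace A) 0.
HB.instance Definition _ A := @isSubBaseTopological.Build (Sspace A)
  (R * R * Sspace A)%type [set i | A i.1.1 /\ 0 < i.1.2] (@Sball A).

Definition test := Sspace [set p | 0 <= p].

Lemma Zprod_S s : Zprod Z s \in Spred [set p | 0 <= p].
Proof.
by rewrite inE /=; split=> [|p _]; [exact: L2Z_Zprod|exact: normp2_Zprod].
Qed.

Definition Ztest (s : Gamma) : test := SSpace (Zprod_S s).

Definition dual A : set (Sspace A -> R[i]^o) :=
  [set Phi : Sspace A -> R[i]^o | linear Phi /\ continuous Phi].

Definition fock (Phi : test -> R[i]^o) (s : Gamma) : R[i] := Phi (Ztest s).

(* The element of S^*(Z) with Fock transform [f]; it is unique because the
   [Zprod s] span a dense subspace of S(Z). The default value 0 is used only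
   when no such element exists. *)
Definition unfock (f : Gamma -> R[i]) : test -> R[i]^o :=
  xget (fun=> 0) [set Phi | dual Phi /\ forall s, fock Phi s = f s].

Definition annih (k : nat) (Phi : test -> R[i]^o) : test -> R[i]^o :=
  unfock (fun s => (1 - (k \in s)%:R) * fock Phi (k |` s)%fset).

Definition creat (k : nat) (Phi : test -> R[i]^o) : test -> R[i]^o :=
  unfock (fun s => (k \in s)%:R * fock Phi (s `\ k)%fset).

Definition expect (Phi : test -> R[i]^o) : test -> R[i]^o :=
  unfock (fun s => fock Phi fset0 * inner P (cst 1) (Zprod Z s)).

(* The continuous linear functionals on S_p(Z) whose restriction to S(Z) is
   [Phi]. *)
Definition extension (p : R) (Phi : test -> R[i]^o)
  : set (Sspace [set p] -> R[i]^o) :=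
  [set F | dual F /\ forall (x : test) (y : Sspace [set p]),
    (y : T -> R[i]^o) = x -> F y = Phi x].
Arguments extension p Phi _ : clear implicits.

Definition dual_p (p : R) : set (test -> R[i]^o) :=
  [set Phi | dual Phi /\ exists F, extension p Phi F].

Definition opnorm (p : R) (F : Sspace [set p] -> R[i]^o) : \bar R :=
  ereal_sup [set (normc (F x))%:E |
    x in [set x : Sspace [set p] | (normp2 Z p x <= 1)%E]].

(* For [Phi] in [dual_p p], the extension is unique since S(Z) is dense in
   S_p(Z), so that this is its operator norm. The default value 0 of [xget] is
   not used there. *)
Definition dual_norm (p : R) (Phi : test -> R[i]^o) : \bar R :=
  opnorm (xget (fun=> 0) (@extension p Phi)).

Definition pair_term (p : R) (Phi Psi : test -> R[i]^o) (s : Gamma) : R[i]^o :=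
  (lambda s `^ (- (2 * p)))%:C%C * fock Phi s * (fock Psi s)^*%C.

Definition pair_defined (p : R) (Phi Psi : test -> R[i]^o) : Prop :=
  (\esum_(s in [set: Gamma]) (normc (pair_term p Phi Psi s))%:E < +oo)%E.

Definition pair (p : R) (Phi Psi : test -> R[i]^o) : R[i] :=
  sum (pair_term p Phi Psi).

Definition Cov_defined (p : R) (Phi Psi : test -> R[i]^o) : Prop :=
  pair_defined p (Phi - expect Phi) (Psi - expect Psi).

Definition Cov (p : R) (Phi Psi : test -> R[i]^o) : R[i] :=
  pair p (Phi - expect Phi) (Psi - expect Psi).

Definition Var_defined (p : R) (Phi : test -> R[i]^o) : Prop :=
  Cov_defined p Phi Phi.

Definition Var (p : R) (Phi : test -> R[i]^o) : R[i] := Cov p Phi Phi.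

End spaces.

(* Main.v *)
(* All the norms involved depend only on the coefficients <Z_s, x>, so the whole
   argument takes place in weighted l^2 spaces of sequences indexed by Gamma. On
   S_p the test vectors
     sum_(s in B) lambda_s^(-2p) conj(F(Z_s)) Z_s, B finite,
   show that sum_s lambda_s^(-2p) |F(Z_s)|^2 is at most the squared norm of F.
   Conversely a sequence f for which that sum is finite is the Fock transform of
   exactly one functional, x |-> sum_s <Z_s, x> f(s). Since the operator
   a_k^dag a_k multiplies the Fock transform by the indicator of [k \in s], and
   since Phi - E Phi has its Fock transform supported by the nonempty s, each of
   which contains at least one k, the inequality holds term by term. *)
Require Import Defs.
From HB Require Import structures.
From mathcomp Require Import all_boot all_order all_algebra.
From mathcomp Require Import finmap.
From mathcomp Require Import complex.
From mathcomp Require Import all_classical all_reals all_analysis.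
From mathcomp Require Import measurable_realfun summability.
From mathcomp Require Import ring lra.
Set Implicit Arguments.
Unset Strict Implicit.
Unset Printing Implicit Defensive.
Import Order.TTheory GRing.Theory Num.Theory.
Import numFieldNormedType.Exports.
Import ComplexField.Normc.
Local Open Scope classical_set_scope.
Local Open Scope ring_scope.


#[local] Existing Instance totally_filter.

(** * Unordered sums of real and complex families *)

Section unordered_sums.
Context {I : choiceType}.

Lemma partial_sumE (V : zmodType) (x : I -> V) (A : {fset I}) :
  partial_sum x A = \sum_(i <- A) x i.
Proof. by rewrite /partial_sum big_seq_fsetE. Qed.

Context {R : realType}.
Implicit Types (a : I -> R) (z : I -> R[i]).

Lemma le_esum_fset a (A : {fset I}) :
  ((\sum_(i <- A) a i)%:E <= \esum_(i in [set: I]) (a i)%:E)%E.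
Proof.
rewrite -sumEFin; apply: esum_ge; exists [set` A]; first by split.
by rewrite fsbig_finite//= set_fsetK.
Qed.

Lemma esum_fset_le a (M : \bar R) :
  (forall A : {fset I}, ((\sum_(i <- A) a i)%:E <= M)%E) ->
  (\esum_(i in [set: I]) (a i)%:E <= M)%E.
Proof.
move=> aM; apply: ge_ereal_sup => _ [X [finX _] <-].
by rewrite fsbig_finite//= sumEFin.
Qed.

Lemma esumZ_le (c : R) (f : I -> \bar R) : 0 <= c -> (forall i, 0 <= f i)%E ->
  (\esum_(i in [set: I]) (c%:E * f i) <= c%:E * \esum_(i in [set: I]) f i)%E.
Proof.
move=> c0 f0; apply: ge_ereal_sup => _ [A [fA _] <-].
rewrite -ge0_mule_fsumr// lee_wpmul2l ?lee_fin//.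
by apply: ereal_sup_ubound; exists A.
Qed.

Lemma fset_sum_mono a (A B : {fset I}) : (forall i, 0 <= a i) ->
  (A `<=` B)%fset -> \sum_(i <- A) a i <= \sum_(i <- B) a i.
Proof.
move=> a0 AB; rewrite [leRHS](big_fsetID _ (mem A))/=.
have -> : [fset x in B | x \in A]%fset = A.
  apply/fsetP => i; rewrite !inE; apply: andb_idl; exact: (fsubsetP AB).
by rewrite lerDl sumr_ge0.
Qed.

(** The finite sums are monotone in the index set and bounded by their supremum, so a finite set
    that comes within [e] of the supremum keeps every larger one within [e]. *)
Lemma cvg_partial_sum_ge0 a : (forall i, 0 <= a i) ->
  (\esum_(i in [set: I]) (a i)%:E < +oo)%E ->
  partial_sum a @ totally --> fine (\esum_(i in [set: I]) (a i)%:E).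
Proof.
move=> a0 aoo.
have e0 : (0 <= \esum_(i in [set: I]) (a i)%:E)%E.
  by apply: esum_ge0 => i _; rewrite lee_fin.
have fe : (\esum_(i in [set: I]) (a i)%:E)%E \is a fin_num by rewrite ge0_fin_numE.
set S := fine _.
have Sub (A : {fset I}) : \sum_(i <- A) a i <= S.
  by rewrite -lee_fin /S fineK//; exact: le_esum_fset.
apply/cvgrPdist_lt => e ep.
have [_ [A [fA _] <-]] := ub_ereal_sup_adherent ep fe.
rewrite -/(esum _ _) -[esum _ _]fineK// -/S fsbig_finite//= sumEFin -EFinB lte_fin => SA.
exists (fset_set A) => // B /= AB; rewrite partial_sumE.
rewrite ger0_norm ?subr_ge0//.
have := fset_sum_mono a0 AB; lra.
Qed.

Lemma normc_ge0 (x : R[i]) : 0 <= normc x.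
Proof. by case: x => u v; exact: sqrtr_ge0. Qed.

Lemma normc_le_ReIm (x : R[i]) : normc x <= `|complex.Re x| + `|complex.Im x|.
Proof.
rewrite -ler_sqr ?nnegrE ?normc_ge0 ?addr_ge0// normc2.
rewrite -[complex.Re x ^+ 2]real_normK ?num_real//.
rewrite -[complex.Im x ^+ 2]real_normK ?num_real//.
have := normr_ge0 (complex.Re x); have := normr_ge0 (complex.Im x); nra.
Qed.

Lemma Re_le_normc (x : R[i]) : `|complex.Re x| <= normc x.
Proof.
rewrite -ler_sqr ?nnegrE ?normc_ge0// normc2 real_normK ?num_real//.
by rewrite lerDl sqr_ge0.
Qed.

Lemma Im_le_normc (x : R[i]) : `|complex.Im x| <= normc x.
Proof.
rewrite -ler_sqr ?nnegrE ?normc_ge0// normc2 real_normK ?num_real//.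
by rewrite lerDr sqr_ge0.
Qed.

(** Absolute convergence reduces to nonnegative families by writing [a] as the difference of
    [a + |a|] and [|a|]. *)
Lemma cvg_partial_sum a : (\esum_(i in [set: I]) (`|a i|)%:E < +oo)%E ->
  cvg (partial_sum a @ totally).
Proof.
move=> aoo.
have aa0 i : 0 <= a i + `|a i|.
  by have := ler_norm (- a i); rewrite normrN; lra.
have aaoo : (\esum_(i in [set: I]) (a i + `|a i|)%:E < +oo)%E.
  apply: (@le_lt_trans _ _ (\esum_(i in [set: I]) ((`|a i|)%:E + (`|a i|)%:E))%E).
    by apply: le_esum => i _; rewrite -EFinD lee_fin lerD2r ler_norm.
  by rewrite esumD ?lte_add_pinfty// => i _; rewrite lee_fin.
have -> : partial_sum a =
    partial_sum (fun i => a i + `|a i|) \- partial_sum (fun i => `|a i|).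
  apply/funext => A; rewrite /= !partial_sumE -sumrB; apply: eq_bigr => i _.
  by rewrite addrK.
by apply: is_cvgB; apply/cvg_ex; eexists; apply: cvg_partial_sum_ge0.
Qed.

Lemma cvg_Complex (J : Type) (G : set_system J) {FG : Filter G}
    (u v : J -> R) (x y : R) :
  u @ G --> x -> v @ G --> y ->
  (fun j => (u j +i* v j)%C : R[i]^o) @ G --> ((x +i* y)%C : R[i]^o).
Proof.
move=> ux vy; apply/cvgrPdist_lt => -[e e'] /=.
(* The order on [R[i]] compares only numbers with equal imaginary parts, so a positive radius is
   real. *)
rewrite ltcE /= => /andP[/eqP -> e0].
have e2 : 0 < e / 2 by rewrite divr_gt0.
near=> j; rewrite /Num.norm/= ltcR.
have h1 : `|x - u j| < e / 2 by near: j; move/cvgrPdist_lt : ux; exact.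
have h2 : `|y - v j| < e / 2 by near: j; move/cvgrPdist_lt : vy; exact.
have := normc_le_ReIm ((x +i* y)%C - (u j +i* v j)%C) => /=.
rewrite /= in h1 h2 *. lra.
Unshelve. all: by end_near. Qed.

Lemma cvg_partial_sumC z : (\esum_(i in [set: I]) (normc (z i))%:E < +oo)%E ->
  cvg ((partial_sum z : {fset I} -> R[i]^o) @ totally).
Proof.
move=> zoo.
have /cvg_ex[/= x zx] : cvg (partial_sum (fun i => complex.Re (z i)) @ totally).
  apply: cvg_partial_sum; apply: le_lt_trans zoo.
  by apply: le_esum => i _; rewrite lee_fin Re_le_normc.
have /cvg_ex[/= y zy] : cvg (partial_sum (fun i => complex.Im (z i)) @ totally).
  apply: cvg_partial_sum; apply: le_lt_trans zoo.
  by apply: le_esum => i _; rewrite lee_fin Im_le_normc.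
apply/cvg_ex; exists ((x +i* y)%C : R[i]^o).
have -> : (partial_sum z : {fset I} -> R[i]^o) = fun A =>
    (partial_sum (fun i => complex.Re (z i)) A +i*
     partial_sum (fun i => complex.Im (z i)) A)%C.
  apply/funext => A; rewrite !partial_sumE.
  rewrite -(raddf_sum (@complex.Re R)) -(raddf_sum (@complex.Im R)).
  by case: (\sum_(i <- A) z i).
exact: cvg_Complex zx zy.
Qed.

Lemma normc_sum_le z (M : R) :
  (\esum_(i in [set: I]) (normc (z i))%:E <= M%:E)%E ->
  normc (sum (z : I -> R[i]^o)) <= M.
Proof.
move=> zM; have /cvg_partial_sumC zc := le_lt_trans zM (ltry _).
apply/ler_addgt0Pr => e e0.
move/cvgrPdist_lt : zc => /(_ e%:C%C).
rewrite ltcR => /(_ e0) [A _ /(_ A (fsubset_refl _))].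
rewrite -/(sum (z : I -> R[i]^o)) /Num.norm/= ltcR => h.
rewrite -[sum _](subrK (partial_sum z A)).
apply: le_trans (le_normcD _ _) _; rewrite addrC lerD ?(ltW h)//.
rewrite partial_sumE.
apply: (@le_trans _ _ (\sum_(i <- A) normc (z i))); last first.
  by rewrite -lee_fin; apply: le_trans zM; exact: le_esum_fset.
elim/big_ind2 : _ => //; first by rewrite normc0.
by move=> a b c f ? ?; apply: le_trans (le_normcD _ _) _; rewrite lerD.
Qed.

Lemma sum_ge0E a : (forall i, 0 <= a i) ->
  (\esum_(i in [set: I]) (a i)%:E < +oo)%E ->
  sum (fun i => (a i)%:C%C : R[i]^o)
    = (fine (\esum_(i in [set: I]) (a i)%:E))%:C%C.
Proof.
move=> a0 aoo; apply: cvg_lim; first exact: norm_hausdorff.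
have -> : partial_sum (fun i => (a i)%:C%C : R[i]^o) =
    fun A => (partial_sum a A +i* 0)%C.
  apply/funext => A; rewrite !partial_sumE; apply/esym.
  exact: (raddf_sum (@real_complex R)).
apply: cvg_Complex; [exact: cvg_partial_sum_ge0|exact: cvg_cst].
Qed.
End unordered_sums.

(** * Weighted l^2 norms of sequences indexed by finite sets *)

Section weighted.
Context {R : realType}.
Implicit Types (u v : Gamma -> R[i]) (q t : R).

(** For [q = 2 * p] and [u] the coefficients of a vector this is its squared S_p norm; for
    [q = - (2 * p)] and [u] a Fock transform it plays the role of the squared dual norm. *)
Definition wnorm2 q u : \bar R :=
  (\esum_(s in [set: Gamma]) (lambda s `^ q * normc (u s) ^+ 2)%:E)%E.

Lemma lambda_gt0 s : 0 < lambda s :> R.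
Proof. by rewrite /lambda; apply: prodr_gt0 => k _; rewrite ltr0n. Qed.

Lemma wnorm2_term_ge0 q s (x : R[i]) : 0 <= lambda s `^ q * normc x ^+ 2.
Proof. by rewrite mulr_ge0 ?powR_ge0 ?sqr_ge0. Qed.

Lemma wnorm2_ge0 q u : (0 <= wnorm2 q u)%E.
Proof. by apply: esum_ge0 => s _; rewrite lee_fin wnorm2_term_ge0. Qed.

(** Coordinatewise, the difference of the two sides is [t^-1 * (t * a - b) ^+ 2]. A small [t] brings
    the first constant close to 1, which replaces the triangle inequality without taking square
    roots. *)
Lemma normc2D_le t (x y : R[i]) : 0 < t ->
  normc (x + y) ^+ 2 <= (1 + t) * normc x ^+ 2 + (1 + t^-1) * normc y ^+ 2.
Proof.
move=> t0; rewrite !normc2.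
have sq (a b : R) : (a + b) ^+ 2 <= (1 + t) * a ^+ 2 + (1 + t^-1) * b ^+ 2.
  rewrite -subr_ge0.
  have -> : (1 + t) * a ^+ 2 + (1 + t^-1) * b ^+ 2 - (a + b) ^+ 2 =
    t^-1 * (t * a - b) ^+ 2 by field; rewrite gt_eqF.
  by rewrite mulr_ge0 ?sqr_ge0// invr_ge0 ltW.
case: x y => [a b] [c e] /=; have := sq a c; have := sq b e; lra.
Qed.

Lemma wnorm2D_le q t u v : 0 < t ->
  (wnorm2 q (fun s => u s + v s)%R <=
   (1 + t)%:E * wnorm2 q u + (1 + t^-1)%:E * wnorm2 q v)%E.
Proof.
move=> t0; have t1 : 0 < t^-1 by rewrite invr_gt0.
have h (c : R) w s : 0 < c -> (0 <= (1 + c)%:E * (lambda s `^ q * normc (w s) ^+ 2)%:E)%E.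
  by move=> c0; rewrite -EFinM lee_fin mulr_ge0 ?wnorm2_term_ge0// addr_ge0// ltW.
apply: (@le_trans _ _ (\esum_(s in [set: Gamma])
    ((1 + t)%:E * (lambda s `^ q * normc (u s) ^+ 2)%:E +
     (1 + t^-1)%:E * (lambda s `^ q * normc (v s) ^+ 2)%:E))%E).
  apply: le_esum => s _; rewrite -!EFinM -EFinD lee_fin.
  rewrite (mulrCA (1 + t)) (mulrCA (1 + t^-1)) -mulrDr ler_wpM2l ?powR_ge0//.
  exact: normc2D_le.
rewrite esumD; [|by move=> s _; exact: h..].
by apply: leeD; apply: esumZ_le;
  rewrite ?addr_ge0 ?ltW// => s; rewrite lee_fin wnorm2_term_ge0.
Qed.

Lemma wnorm2_fset q (A : {fset Gamma}) u :
  wnorm2 q (fun s => (s \in A)%:R * u s) =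
  (\sum_(s <- A) lambda s `^ q * normc (u s) ^+ 2)%:E.
Proof.
rewrite -sumEFin -[in RHS](set_fsetK A) -fsbig_finite//= -esum_fset//; last first.
  by move=> s _; rewrite lee_fin wnorm2_term_ge0.
rewrite [RHS]esum_mkcond; apply: eq_esum => s _.
have -> : (s \in [set` A]) = (s \in A).
  by apply/idP/idP => h; [rewrite inE in h|rewrite inE].
by case: (s \in A); rewrite ?mul1r// mul0r normc0 expr0n mulr0.
Qed.

(** The tail is the whole sum minus the partial sum over [A], and the partial sums converge to the
    whole. *)
Lemma wnorm2_tail q u e : 0 < e -> (wnorm2 q u < +oo)%E ->
  \forall A \near totally, (wnorm2 q (fun s => (s \notin A)%:R * u s)%R < e%:E)%E.
Proof.
move=> e0 uoo.
have /cvgrPdist_lt/(_ _ e0)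
  := cvg_partial_sum_ge0 (fun s => wnorm2_term_ge0 q s (u s)) uoo.
apply: filterS => A; rewrite -/(wnorm2 q u) partial_sumE.
set S := \sum_(s <- A) _.
have -> : wnorm2 q u = (S%:E + wnorm2 q (fun s => (s \notin A)%:R * u s)%R)%E.
  rewrite /S -wnorm2_fset -esumD; last 2 first.
  - by move=> s _; rewrite lee_fin; exact: wnorm2_term_ge0.
  - by move=> s _; rewrite lee_fin; exact: wnorm2_term_ge0.
  apply: eq_esum => s _; rewrite -EFinD.
  by case: (s \in A); rewrite /= mul1r mul0r normc0 expr0n mulr0 ?addr0 ?add0r.
have : (wnorm2 q (fun s => (s \notin A)%:R * u s)%R <= wnorm2 q u)%E.
  apply: le_esum => s _; case: (s \in A); rewrite /= ?mul1r// mul0r normc0 expr0n mulr0.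
  by rewrite lee_fin wnorm2_term_ge0.
move=> /le_lt_trans/(_ uoo); have := wnorm2_ge0 q (fun s => (s \notin A)%:R * u s).
case: (wnorm2 _ _) => //= r r0 _.
rewrite lte_fin; have := ler_norm (S + r - S); lra.
Qed.
End weighted.

(** * Convergence and continuity in the topology generated by the norms *)

Section topology.
Context {R : realType} {d : measure_display} {T : measurableType d}.
Context {P : probability T R} {Z : normal_noise P}.
Implicit Types (A : set R) (p : R).

Definition Zcoef A (s : Gamma) (x : Sspace Z A) : R[i]^o := inner P (Zprod Z s) x.

Lemma Sspace_L2 A (x : Sspace Z A) : L2Z Z x.
Proof. by case: x => f fS; have := fS; rewrite inE /= => -[]. Qed.

Lemma normp2_wnorm2 A p (x : Sspace Z A) :
  normp2 Z p x = wnorm2 (2 * p) (fun s => Zcoef s x).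
Proof. by []. Qed.

Lemma Sspace_lty A p (x : Sspace Z A) : A p ->
  (wnorm2 (2 * p) (fun s => Zcoef s x) < +oo)%E.
Proof. by move=> Ap; case: x => f h; have := h; rewrite inE /= => -[_ /(_ p Ap)]. Qed.

Fact Zcoef_is_linear A s : linear (@Zcoef A s).
Proof. by move=> a x y; rewrite /Zcoef -inner_linear//; exact: Sspace_L2. Qed.

HB.instance Definition _ A s :=
  GRing.isLinear.Build R[i] (Sspace Z A) R[i]^o _ (@Zcoef A s) (@Zcoef_is_linear A s).

Lemma ZcoefB A s (x y : Sspace Z A) : Zcoef s (x - y) = Zcoef s x - Zcoef s y.
Proof. exact: linearB. Qed.

Lemma SballE A i (x : Sspace Z A) :
  Sball i x = (wnorm2 (2 * i.1.1) (fun s => Zcoef s (x - i.2)%R) < (i.1.2 ^+ 2)%:E)%E.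
Proof. by []. Qed.

Lemma open_Sball A i : A i.1.1 -> 0 < i.1.2 -> open (@Sball _ _ _ _ Z A i).
Proof.
move=> Ai i0.
exists [set Sball i]; last by rewrite bigcup_set1.
move=> _ ->; apply: finI_from1; by split.
Qed.

(** The subbase consists of balls with arbitrary centres, whereas the hypothesis concerns balls
    around [x]. A neighbourhood of [x] contains a finite intersection of subbase balls, and in each
    of them the strict inequality at [x] leaves room for a small ball around [x]. *)
Lemma cvg_Sspace A (J : Type) (G : set_system J) {FG : Filter G}
    (h : J -> Sspace Z A) (x : Sspace Z A) :
  (forall p e, A p -> 0 < e -> \forall j \near G,
     (wnorm2 (2 * p) (fun s => Zcoef s (h j - x)%R) < e%:E)%E) ->
  h @ G --> x.
Proof.
move=> hx U; rewrite nbhsE => -[B [oB Bx] BU].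
have [D sD eB] : exists2 D, D `<=` finI_from
  [set i : (R * R * Sspace Z A)%type | A i.1.1 /\ 0 < i.1.2] (@Sball _ _ _ _ Z A) &
  \bigcup_(V in D) V = B by case: oB => D sD eB; exists D.
move: Bx; rewrite -eB => -[V DV Vx].
have [F sF FV] := sD _ DV.
apply: (@filterS _ G _ (h @^-1` V)) => [j Vj|].
  by apply: BU; rewrite -eB; exists V.
rewrite -FV preimage_bigcap; apply: filter_bigI => i iF.
have [Ai i0] : A i.1.1 /\ 0 < i.1.2 by have := sF _ iF; rewrite inE.
have : Sball i x by move: Vx; rewrite -FV; apply.
rewrite SballE; set N := wnorm2 _ _ => Nlt.
have N0 : (0 <= N)%E by exact: wnorm2_ge0.
have [n Nn] : exists n : R, N = n%:E.
  by move: N0 Nlt; case: N => // r _ _; exists r.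
rewrite Nn lte_fin in Nlt; rewrite Nn lee_fin in N0.
set e := i.1.2 ^+ 2 in Nlt *.
(* a weight t so small that (1 + t) n stays below e *)
pose t := (e - n) / (2 * (n + 1)).
have t0 : 0 < t by rewrite divr_gt0 ?subr_gt0// mulr_gt0// ltr_wpDl.
have t1 : (1 + t) * n < e.
  have : t * (n + 1) = (e - n) / 2 by rewrite /t; field; rewrite gt_eqF// ltr_wpDl.
  lra.
(* This [r] uses up the remaining room: [(1 + t) * n + (1 + t^-1) * r = e]. *)
pose r := (e - (1 + t) * n) / (1 + t^-1).
have tv : 0 < 1 + t^-1 by rewrite addr_gt0 ?invr_gt0.
have r0 : 0 < r by rewrite divr_gt0// subr_gt0.
apply: filterS (hx _ _ Ai r0) => j hj.
rewrite /preimage /mkset SballE.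
have -> : (fun s => Zcoef s (h j - i.2)) =
    (fun s => Zcoef s (x - i.2) + Zcoef s (h j - x)).
  by apply/funext => s; rewrite !ZcoefB [RHS]addrC addrA subrK.
apply: le_lt_trans (wnorm2D_le _ _ _ t0) _; rewrite -/N Nn.
have -> : (i.1.2 ^+ 2)%:E = (((1 + t) * n)%:E + (1 + t^-1)%:E * r%:E)%E.
  have er : (1 + t^-1) * r = e - (1 + t) * n by rewrite /r mulrC divfK ?gt_eqF.
  by rewrite -EFinM -EFinD er addrC subrK.
by rewrite -EFinM lteD2lE// lte_pmul2l.
Qed.

(** By linearity the increment of [F] between [x] and [y] is [F (y - x)], so the bound near 0
    applies on the open ball of radius [r] around [x]. *)
Lemma Sspace_continuous A p (F : Sspace Z A -> R[i]^o) : A p -> linear F ->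
  (forall e, 0 < e -> exists2 r, 0 < r & forall x,
     (wnorm2 (2 * p) (fun s => Zcoef s x) < (r ^+ 2)%:E)%E -> normc (F x) < e) ->
  continuous F.
Proof.
move=> Ap lF hF x; apply/(@cvgrPdist_lt _ _ _ (nbhs x) (nbhs_filter x)) => -[e e'].
rewrite ltcE /= => /andP[/eqP -> e0].
have [r r0 Fr] := hF e e0.
near=> y; rewrite -normrN opprB.
have -> : F y - F x = F (y - x).
  by have := lF 1 (y - x) x; rewrite !scale1r subrK => ->; rewrite addrK.
rewrite /Num.norm/= ltcR; apply: Fr; rewrite -normp2_wnorm2.
near: y; apply: open_nbhs_nbhs; split; first exact: (@open_Sball A ((p, r), x)).
by rewrite /= subrr normp20 lte_fin exprn_gt0.
Unshelve. all: by end_near. Qed.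
End topology.

(** * Continuous functionals and bounds on their values at the basis *)

Section functionals.
Context {R : realType} {d : measure_display} {T : measurableType d}.
Context {P : probability T R} {Z : normal_noise P}.
Implicit Types (A : set R) (p : R) (B : {fset Gamma}).

Lemma Zprod_Spred A s : Zprod Z s \in Spred Z A.
Proof.
by rewrite inE /=; split=> [|p _]; [exact: L2Z_Zprod|exact: normp2_Zprod].
Qed.

(** [Ztest] lives in S(Z) only; extensions of a functional to S_p(Z) must be evaluated at the same
    vectors seen as elements of S_p(Z). *)
Definition Zelt A s : Sspace Z A := SSpace (Zprod_Spred A s).

Lemma ZtestE s : Ztest Z s = Zelt [set p | 0 <= p] s.
Proof. exact: val_inj. Qed.

Lemma Zcoef_Zelt A s t : Zcoef t (Zelt A s) = (t == s)%:R.
Proof. exact: inner_ZZ. Qed.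

Definition lincomb A B (c : Gamma -> R[i]) : Sspace Z A :=
  \sum_(s <- B) c s *: Zelt A s.

Lemma Zcoef_lincomb A B c t : Zcoef t (lincomb A B c) = (t \in B)%:R * c t.
Proof.
rewrite /lincomb linear_sum /=.
under eq_bigr do rewrite linearZ /= Zcoef_Zelt.
have [tB|tB] := boolP (t \in B); last first.
  rewrite big1_fset ?mul0r// => s sB _.
  by case: eqVneq => [ts|_]; [rewrite ts sB in tB|rewrite scaler0].
rewrite (big_fsetD1 t)//= eqxx big1_fset ?addr0 => [|s].
  by rewrite mul1r; exact: mulr1.
by rewrite !inE => /andP[st _] _; rewrite eq_sym (negbTE st) scaler0.
Qed.

Lemma linear_lincomb A B c (F : Sspace Z A -> R[i]^o) : linear F ->
  F (lincomb A B c) = \sum_(s <- B) c s * F (Zelt A s).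
Proof.
move=> lF; pose L : {linear _ -> _} := HB.pack F (GRing.isLinear.Build _ _ _ _ F lF).
rewrite -[F]/(L : _ -> _) linear_sum; apply: eq_bigr => s _; exact: linearZ.
Qed.

(** Up to sign, the coefficients of the difference are the tail of those of [x], which is small in
    every norm with index in [A]. *)
Lemma lincomb_cvg A (x : Sspace Z A) :
  lincomb A B (fun s => Zcoef s x) @[B --> totally] --> x.
Proof.
apply: cvg_Sspace => p e Ap e0.
apply: filterS (wnorm2_tail e0 (Sspace_lty x Ap)) => B.
congr (_ < _)%E; apply: eq_esum => s _; rewrite ZcoefB Zcoef_lincomb.
congr ((_ * _ ^+ 2)%:E); move: (Zcoef s x) => z; rewrite -[RHS]normcN; congr normc.
by case: (s \in B) => /=; ring.
Qed.

(** Both functionals agree on the finite expansions of [x]; by continuity their values there tend to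
    [F x] and [G x], and limits in [R[i]] are unique. *)
Lemma dual_ext A (F G : Sspace Z A -> R[i]^o) : dual F -> dual G ->
  (forall s, F (Zelt A s) = G (Zelt A s)) -> F = G.
Proof.
move=> [lF cF] [lG cG] FG; apply/funext => x.
have hF := cvg_comp _ _ (@lincomb_cvg _ x) (cF x).
have hG := cvg_comp _ _ (@lincomb_cvg _ x) (cG x).
apply: (cvg_unique _ hF); first exact: norm_hausdorff.
apply: cvg_trans hG; apply: near_eq_cvg; apply: nearW => B /=.
by rewrite !linear_lincomb//; apply: eq_bigr => s _; rewrite FG.
Qed.

(* For [c = 1], the vector that represents (Riesz) the restriction of [F] to the
   span of the [Zprod s], [s \in B], for the inner product of S_p(Z). *)
Definition riesz A p B (F : Sspace Z A -> R[i]^o) (c : R) : Sspace Z A :=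
  lincomb A B (fun s => (c * lambda s `^ (- (2 * p)))%:C%C * (F (Zelt A s))^*%C).

Definition dual_sum A p B (F : Sspace Z A -> R[i]^o) : R :=
  \sum_(s <- B) lambda s `^ (- (2 * p)) * normc (F (Zelt A s)) ^+ 2.

Lemma normc_real (a : R) : normc a%:C%C = `|a|.
Proof. by rewrite /normc /= expr0n addr0 sqrtr_sqr. Qed.

Lemma normc_conj (z : R[i]) : normc z^*%C = normc z.
Proof. by case: z => a b; rewrite /normc /= sqrrN. Qed.

Lemma mulr_conj (z : R[i]) : z^*%C * z = (normc z ^+ 2)%:C%C.
Proof. by rewrite normc2; case: z => a b; congr Complex => /=; ring. Qed.

Lemma dual_sum_ge0 A p B (F : Sspace Z A -> R[i]^o) : 0 <= dual_sum p B F.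
Proof. by apply: sumr_ge0 => s _; exact: wnorm2_term_ge0. Qed.

(** The weight [lambda s]^ (2 * p)[of the norm cancels one of the two factors]lambda s
    [^ (- (2 * p))] produced by squaring the coefficient. *)
Lemma riesz_norm A p B (F : Sspace Z A -> R[i]^o) c :
  wnorm2 (2 * p) (fun s => Zcoef s (riesz p B F c)) =
  (c ^+ 2 * dual_sum p B F)%:E.
Proof.
rewrite /riesz.
under eq_fun do rewrite Zcoef_lincomb.
rewrite wnorm2_fset /dual_sum mulr_sumr; congr EFin; apply: eq_bigr => s _.
rewrite normcM normc_conj normc_real exprMn real_normK ?num_real// powRN.
by field; rewrite gt_eqF// powR_gt0// lambda_gt0.
Qed.

Lemma riesz_eval A p B (F : Sspace Z A -> R[i]^o) c : linear F ->
  F (riesz p B F c) = (c * dual_sum p B F)%:C%C.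
Proof.
move=> lF; rewrite linear_lincomb// /dual_sum mulr_sumr.
rewrite (raddf_sum (@real_complex R)); apply: eq_bigr => s _.
by rewrite -mulrA mulr_conj mulrA [RHS]rmorphM.
Qed.

(** The norm balls around 0 form a filter base whose filter converges to 0, because [[set p]]
    provides only one norm; continuity of [F] at 0 along this filter gives the radius. *)
Lemma dual_small p (F : Sspace Z [set p] -> R[i]^o) : dual F ->
  exists2 e, 0 < e & forall x,
    (wnorm2 (2 * p) (fun s => Zcoef s x) < e%:E)%E -> normc (F x) < 1.
Proof.
move=> [lF cF].
pose G := filter_from [set e : R | 0 < e]
  (fun e => [set x : Sspace Z [set p] | (wnorm2 (2 * p) (fun s => Zcoef s x) < e%:E)%E]).
have FG : Filter G.
  apply: filter_from_filter; first by exists 1 => /=.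
  move=> i j /= i0 j0; exists (Num.min i j); first by rewrite /= lt_min i0.
  by move=> x /= xij; split; apply: lt_le_trans xij _; rewrite lee_fin ge_min lexx ?orbT.
have G0 : id @ G --> (0 : Sspace Z [set p]).
  apply: cvg_Sspace => q e -> e0; exists e => // x /=.
  by rewrite subr0.
have F0 : F 0 = 0 by have := lF (-1) 0 0; rewrite scaler0 addr0 scaleN1r addNr.
have /cvgrPdist_lt/(_ 1 ltr01) := cvg_comp _ _ G0 (cF 0).
move=> [e e0 h]; exists e => // x /h /=.
by rewrite F0 sub0r normrN /Num.norm/= ltcR.
Qed.

(** Every partial sum [S] is at most [2 / e]: otherwise a multiple of the Riesz vector would lie in
    the ball on which [F] is below 1 and yet have a value above 1. *)
Lemma dual_wnorm2_lty p (F : Sspace Z [set p] -> R[i]^o) : dual F ->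
  (wnorm2 (- (2 * p)) (fun s => F (Zelt [set p] s)) < +oo)%E.
Proof.
move=> dF; have [e e0 Fe] := dual_small dF; case: dF => lF _.
apply: (@le_lt_trans _ _ (2 / e)%:E); last exact: ltry.
apply: esum_fset_le => B; rewrite lee_fin leNgt; apply/negP.
rewrite -/(dual_sum p B F); set S := dual_sum p B F => eS.
have S0 : 0 < S by apply: lt_trans eS; rewrite divr_gt0.
(* This scaling gives the Riesz vector squared norm [e / 2]; the square of the value of [F] there is
   [e * S / 2], which exceeds 1 when [S] exceeds [2 / e]. *)
pose c := Num.sqrt (e / (2 * S)).
have c2 : c ^+ 2 = e / (2 * S) by rewrite sqr_sqrtr// divr_ge0 ?mulr_ge0// ltW.
have c2S : c ^+ 2 * S = e / 2 by rewrite c2; field; rewrite gt_eqF.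
have : normc (F (riesz p B F c)) < 1.
  by apply: Fe; rewrite riesz_norm lte_fin -/S c2S; lra.
rewrite riesz_eval// -/S normc_real => h.
have : `|c * S| ^+ 2 < 1 by rewrite expr_lt1.
rewrite real_normK ?num_real// exprMn [S ^+ 2]expr2 mulrA c2S => eS1.
by move: eS; rewrite ltr_pdivrMr//; lra.
Qed.

(** If a partial sum [S] is positive, the Riesz vector divided by the square root of [S] has norm 1,
    and [F] takes the value square root of [S] at it. *)
Lemma wnorm2_le_opnorm p (F : Sspace Z [set p] -> R[i]^o) : linear F ->
  (wnorm2 (- (2 * p)) (fun s => F (Zelt [set p] s)) <= opnorm F ^+ 2)%E.
Proof.
move=> lF; apply: esum_fset_le => B.
rewrite -/(dual_sum p B F); have := dual_sum_ge0 p B F.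
rewrite le_eqVlt => /orP[/eqP <-|S0]; first exact: sqre_ge0.
set S := dual_sum p B F in S0 *.
have sS : 0 < Num.sqrt S by rewrite sqrtr_gt0.
pose c := (Num.sqrt S)^-1.
have h : ((Num.sqrt S)%:E <= opnorm F)%E.
  apply: ereal_sup_ubound; exists (riesz p B F c).
    rewrite /= normp2_wnorm2 riesz_norm -/S lee_fin /c exprVn (sqr_sqrtr (ltW S0)).
    by rewrite mulVf ?gt_eqF.
  rewrite riesz_eval// -/S normc_real /c.
  have -> : (Num.sqrt S)^-1 * S = Num.sqrt S.
    by rewrite -[X in _ * X](sqr_sqrtr (ltW S0)) expr2 mulKf ?gt_eqF.
  by rewrite ger0_norm ?sqrtr_ge0.
rewrite -(sqr_sqrtr (ltW S0)) expr2 EFinM expe2.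
by apply: lee_pmul => //; rewrite lee_fin ltW.
Qed.
End functionals.

(** * Functionals with a prescribed Fock transform *)

Section representation.
Context {R : realType} {d : measure_display} {T : measurableType d}.
Context {P : probability T R} {Z : normal_noise P}.
Implicit Types (A : set R) (p : R) (f : Gamma -> R[i]).

(** The index set [A] is left free because the same series serves as a functional on S(Z) and as its
    extension to S_p(Z). *)
Definition series_form A f (x : Sspace Z A) : R[i]^o :=
  sum (fun s => Zcoef s x * f s : R[i]^o).

(** A weighted Young inequality, applied to each term, stands in for Cauchy-Schwarz; the free
    parameter [t] later balances the two sums in the proof of continuity. *)
Lemma esum_Zcoef_le A p f (x : Sspace Z A) t : 0 < t ->
  (\esum_(s in [set: Gamma]) (normc (Zcoef s x * f s)%R)%:E <=
   t%:E * wnorm2 (2 * p) (fun s => Zcoef s x) +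
   t^-1%:E * wnorm2 (- (2 * p)) f)%E.
Proof.
move=> t0; have ti0 : 0 < t^-1 by rewrite invr_gt0.
have h q (c : R) (z : R[i]) s : 0 < c ->
    (0 <= c%:E * (lambda s `^ q * normc z ^+ 2)%:E)%E.
  by move=> c0; rewrite -EFinM lee_fin mulr_ge0 ?wnorm2_term_ge0// ltW.
apply: (@le_trans _ _ (\esum_(s in [set: Gamma])
    (t%:E * (lambda s `^ (2 * p) * normc (Zcoef s x) ^+ 2)%:E +
     t^-1%:E * (lambda s `^ (- (2 * p)) * normc (f s) ^+ 2)%:E))%E).
  apply: le_esum => s _; rewrite -!EFinM -EFinD lee_fin normcM powRN.
  set a := normc _; set b := normc _; set l := lambda s `^ _.
  have l0 : 0 < l by rewrite powR_gt0// lambda_gt0.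
  have a0 : 0 <= a by exact: normc_ge0.
  have b0 : 0 <= b by exact: normc_ge0.
  apply: (@le_trans _ _ (2 * (a * b))); first by have := mulr_ge0 a0 b0; lra.
  rewrite -subr_ge0.
  have -> : t * (l * a ^+ 2) + t^-1 * (l^-1 * b ^+ 2) - 2 * (a * b) =
    (t * l)^-1 * (t * l * a - b) ^+ 2 by field; rewrite !gt_eqF.
  by rewrite mulr_ge0 ?sqr_ge0// invr_ge0 mulr_ge0 ?ltW.
rewrite esumD; [|by move=> s _; exact: h..].
by apply: leeD; apply: esumZ_le; rewrite ?ltW// => s;
  rewrite lee_fin wnorm2_term_ge0.
Qed.

Lemma series_form_Zelt A f s : series_form f (Zelt (Z := Z) A s) = f s.
Proof.
apply: cvg_lim; first exact: norm_hausdorff.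
apply: cvg_near_cst; exists [fset s]%fset => // B /= sB.
have {}sB : s \in B by apply: (fsubsetP sB); rewrite inE.
rewrite partial_sumE (big_fsetD1 s)//= Zcoef_Zelt eqxx mul1r big1_fset ?addr0//.
by move=> t; rewrite !inE => /andP[ts _] _; rewrite Zcoef_Zelt (negbTE ts) mul0r.
Qed.
Section fixed_index.
Context A p f (Ap : A p) (f_lty : (wnorm2 (- (2 * p)) f < +oo)%E).

Lemma esum_Zcoef_lty (x : Sspace Z A) :
  (\esum_(s in [set: Gamma]) (normc (Zcoef s x * f s)%R)%:E < +oo)%E.
Proof.
apply: le_lt_trans (esum_Zcoef_le p f x ltr01) _.
by rewrite lte_add_pinfty// lte_mul_pinfty// ?invr1 ?lee_fin// Sspace_lty.
Qed.

Lemma series_form_cvg (x : Sspace Z A) :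
  (partial_sum (fun s => Zcoef s x * f s) : {fset Gamma} -> R[i]^o) B
    @[B --> totally] --> series_form f x.
Proof. exact: cvg_partial_sumC (esum_Zcoef_lty x). Qed.

Lemma series_form_linear : linear (@series_form A f).
Proof.
move=> a x y; apply: cvg_lim; first exact: norm_hausdorff.
pose u (z : Sspace Z A) : {fset Gamma} -> R[i]^o :=
  partial_sum (fun s => Zcoef s z * f s).
suff : u (a *: x + y) @ totally --> a *: series_form f x + series_form f y by [].
have -> : u (a *: x + y) = (fun B => a *: u x B) \+ u y.
  apply/funext => B; rewrite /= /u !partial_sumE scaler_sumr -big_split.
  by apply: eq_bigr => s _ /=; rewrite linearP mulrDl -scalerAl.
exact: cvgD (cvgZl_tmp (@series_form_cvg x)) (@series_form_cvg y).
Qed.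

Lemma series_form_continuous : continuous (@series_form A f).
Proof.
apply: (Sspace_continuous Ap series_form_linear) => e e0.
have [m mE] : exists m : R, wnorm2 (- (2 * p)) f = m%:E.
  by move: (wnorm2_ge0 (- (2 * p)) f) f_lty; case: wnorm2 => // m; exists m.
have m0 : 0 <= m by rewrite -lee_fin -mE wnorm2_ge0.
(* This makes the contribution of [f], namely [t^-1 * m], at most [e / 2]; the summand 1 keeps [t]
   positive when [m] is 0. *)
pose t := 2 * (m + 1) / e.
have t0 : 0 < t by rewrite divr_gt0// mulr_gt0// ltr_wpDl.
have tm : t^-1 * m <= e / 2.
  have -> : t^-1 * m = e / 2 * (m / (m + 1)).
    by rewrite /t; field; rewrite !gt_eqF// ltr_wpDl.
  rewrite ler_piMr ?divr_ge0 ?(ltW e0)// ler_pdivrMr ?mul1r; last by rewrite ltr_wpDl.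
  by rewrite lerDl.
(* With this radius the contribution of the vector, [t * n], stays below the other [e / 2]. *)
exists (Num.sqrt (e / (2 * t))); first by rewrite sqrtr_gt0 divr_gt0// mulr_gt0.
rewrite sqr_sqrtr => [x|]; last by apply/ltW/divr_gt0 => //; exact: mulr_gt0.
set N := wnorm2 _ _ => Nlt.
have [n Nn] : exists n : R, N = n%:E.
  by move: (wnorm2_ge0 (2 * p) (fun s => Zcoef s x)) Nlt; rewrite -/N;
    case: N => // n; exists n.
apply: (@le_lt_trans _ _ (t * n + t^-1 * m)).
  apply: normc_sum_le; apply: le_trans (esum_Zcoef_le p f x t0) _.
  by rewrite -/N Nn mE.
move: Nlt; rewrite Nn lte_fin => Nlt.
have : t * n < e / 2.
  have -> : e / 2 = t * (e / (2 * t)) by field; rewrite gt_eqF.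
  by rewrite ltr_pM2l.
lra.
Qed.

Lemma series_form_dual : dual (@series_form A f).
Proof. by split; [exact: series_form_linear|exact: series_form_continuous]. Qed.

End fixed_index.

Section unfock.
Context p f (p0 : 0 <= p) (f_lty : (wnorm2 (- (2 * p)) f < +oo)%E).

(** The series shows that a functional with Fock transform [f] exists, so the default of [xget] does
    not occur; [dual_ext] shows that the chosen one is the series. *)
Lemma unfockE : unfock (Z := Z) f = @series_form [set q | 0 <= q] f.
Proof.
have dL : dual (@series_form [set q | 0 <= q] f) by exact: series_form_dual f_lty.
rewrite /unfock; case: xgetP => [Psi _ [dPsi fPsi]|/(_ (@series_form _ f))[]].
  apply: dual_ext => // s; rewrite -ZtestE [LHS]fPsi.
  by rewrite ZtestE series_form_Zelt.
by split=> // s; rewrite /fock ZtestE series_form_Zelt.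
Qed.

Lemma fock_unfock s : fock (unfock (Z := Z) f) s = f s.
Proof. by rewrite unfockE /fock ZtestE series_form_Zelt. Qed.

(** Whichever extension [xget] picks, its values at the basis are those of [f], so the operator norm
    bound applies. The series on S_p(Z) is an extension, which excludes the default value. *)
Lemma wnorm2_le_dual_norm :
  (wnorm2 (- (2 * p)) f <= dual_norm p (unfock (Z := Z) f) ^+ 2)%E.
Proof.
rewrite /dual_norm; case: xgetP => [F _ [[lF _] eF]|/(_ (@series_form [set p] f))[]].
  apply: le_trans (wnorm2_le_opnorm lF); apply: le_esum => s _.
  by rewrite (eF (Ztest Z s))// [_ (Ztest Z s)]fock_unfock.
split; first exact: series_form_dual f_lty.
move=> x y xy; rewrite unfockE; congr sum; apply/funext => s.
by rewrite /Zcoef xy.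
Qed.
End unfock.

Lemma dual_p_lty p (Phi : test Z -> R[i]^o) : dual_p p Phi ->
  (wnorm2 (- (2 * p)) (fock Phi) < +oo)%E.
Proof.
move=> [_ [F [dF eF]]]; have := dual_wnorm2_lty dF.
congr (_ < _)%E; apply: eq_esum => s _; congr ((_ * normc _ ^+ 2)%:E).
exact: eF.
Qed.
End representation.

(** * Annihilation, creation and expectation on Fock transforms *)

Section number_operators.
Context {R : realType} {d : measure_display} {T : measurableType d}.
Context {P : probability T R} {Z : normal_noise P}.
Implicit Types (q : R) (u v : Gamma -> R[i]).

Lemma le_wnorm2 q u v : (forall s, normc (u s) <= normc (v s)) ->
  (wnorm2 q u <= wnorm2 q v)%E.
Proof.
move=> uv; apply: le_esum => s _; rewrite lee_fin ler_wpM2l ?powR_ge0//.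
by rewrite ler_sqr ?nnegrE ?normc_ge0.
Qed.

Lemma wnorm2_mask q (b : pred Gamma) u :
  (wnorm2 q (fun s => (b s)%:R * u s)%R <= wnorm2 q u)%E.
Proof.
by apply: le_wnorm2 => s; case: (b s); rewrite ?mul1r// mul0r normc0 normc_ge0.
Qed.

Lemma lambdaU (k : nat) s : k \notin s -> lambda (k |` s)%fset = k.+1%:R * lambda s :> R.
Proof. by move=> ks; rewrite /lambda big_fsetU1. Qed.

(** This keeps [annih k] within the weighted space. Adding [k] is injective on the sets without [k]
    and multiplies [lambda] by [k + 1], so the norm grows at most by the constant [c]. *)
Lemma wnorm2_shift q (k : nat) u : (wnorm2 q u < +oo)%E ->
  (wnorm2 q (fun s => (1 - (k \in s)%:R) * u (k |` s)%fset)%R < +oo)%E.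
Proof.
move=> u_lty; pose c : R := (k.+1%:R `^ q)^-1.
have c0 : 0 <= c by rewrite invr_ge0 powR_ge0.
apply: (@le_lt_trans _ _ (c%:E * wnorm2 q u)%E); last first.
  by rewrite lte_mul_pinfty// lee_fin.
pose g s := (c%:E * (lambda s `^ q * normc (u s) ^+ 2)%:E)%E.
have g0 s : (0 <= g s)%E by rewrite /g -EFinM lee_fin mulr_ge0 ?wnorm2_term_ge0.
apply: (@le_trans _ _ (\esum_(s in [set: Gamma]) g s)%E); last first.
  by apply: esumZ_le => // s; rewrite lee_fin wnorm2_term_ge0.
pose N := [set s : Gamma | k \notin s].
pose e (s : Gamma) := (k |` s)%fset.
have e_inj : set_inj N e.
  move=> s t /set_mem sN /set_mem tN est.
  by rewrite -(fsetU1K sN) -(fsetU1K tN); congr (_ `\ _)%fset.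
apply: (@le_trans _ _ (\esum_(s in N) g (e s))%E).
  rewrite [leRHS]esum_mkcond; apply: le_esum => s _; rewrite /N.
  have -> : (s \in [set s : Gamma | k \notin s]) = (k \notin s).
    by apply/idP/idP => h; [rewrite inE in h|rewrite inE].
  have [ks|ks] := boolP (k \in s); first by rewrite subrr mul0r normc0 expr0n mulr0.
  rewrite subr0 mul1r /= /g /e -EFinM lee_fin lambdaU// powRM ?ler0n//; last first.
    by rewrite ltW// lambda_gt0.
  by rewrite -mulrA /c mulKf// gt_eqF// powR_gt0.
rewrite -(esum_image N e g e_inj) esum_mkcond; apply: le_esum => s _.
by case: ifP.
Qed.

(** A nonempty [s] contains some [k], so its term reappears in the summand of index [k]; the finite
    sum over [s] and the series over [k] are then exchanged, all terms being nonnegative. *)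
Lemma wnorm2_nonempty_le q u :
  (wnorm2 q (fun s => (s != fset0)%:R * u s)%R <=
   \sum_(0 <= k <oo) wnorm2 q (fun s => (k \in s)%:R * u s)%R)%E.
Proof.
pose t (k : nat) (s : Gamma) : \bar R :=
  (lambda s `^ q * normc ((k \in s)%:R * u s) ^+ 2)%:E.
have t0 k s : (0 <= t k s)%E by rewrite lee_fin wnorm2_term_ge0.
apply: esum_fset_le => B; rewrite -sumEFin.
apply: (@le_trans _ _ (\sum_(s <- B) \sum_(0 <= k <oo) t k s)%E).
  apply: lee_sum => s _; have [->|/fset0Pn[k ks]] := eqVneq s fset0.
    by rewrite mul0r normc0 expr0n mulr0; apply: nneseries_ge0.
  (* Truncation at [k.+1] is the first that includes the index [k]. *)
  apply: le_trans (nneseries_lim_ge k.+1 _); last by [].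
  rewrite big_nat_recr//= mul1r; have -> : (lambda s `^ q * normc (u s) ^+ 2)%:E = t k s.
    by rewrite /t ks mul1r.
  by rewrite leeDr // sume_ge0.
rewrite -nneseries_sum//; apply: lee_nneseries => [k _ _|k _].
  by apply: sume_ge0.
by rewrite /t sumEFin /wnorm2; exact: le_esum_fset.
Qed.

(** The constant 1 is the basis vector of the empty set, so orthonormality turns the inner product
    into an indicator; the masked sequence is summable, hence a genuine Fock transform. *)
Lemma expectE p (Phi : test Z -> R[i]^o) s : 0 <= p ->
  (wnorm2 (- (2 * p)) (fock Phi) < +oo)%E ->
  fock (expect Phi) s = (s == fset0)%:R * fock Phi s.
Proof.
move=> p0 Phi_lty.
have E t : fock Phi fset0 * inner P (cst 1) (Zprod Z t) = (t == fset0)%:R * fock Phi t.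
  have -> : (cst 1 : T -> R[i]^o) = Zprod Z fset0.
    by apply/funext => w; rewrite /Zprod big_seq_fset0.
  rewrite inner_ZZ eq_sym mulrC; case: eqVneq => [->//|_]; by rewrite !mul0r.
rewrite /expect (_ : (fun _ => _) = fun t => (t == fset0)%:R * fock Phi t).
  by rewrite (fock_unfock p0)//; apply: le_lt_trans Phi_lty; exact: wnorm2_mask.
by apply/funext.
Qed.

(** For [k] in [s], removing [k] and adding it back restores [s], and the factor of [annih] at the
    set without [k] is 1. *)
Lemma creat_annihE p (Phi : test Z -> R[i]^o) k : 0 <= p ->
  (wnorm2 (- (2 * p)) (fock Phi) < +oo)%E ->
  creat k (annih k Phi) = unfock (fun s => (k \in s)%:R * fock Phi s).
Proof.
move=> p0 Phi_lty; congr unfock; apply/funext => s.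
rewrite (fock_unfock p0); last exact: wnorm2_shift.
have [ks|ks] := boolP (k \in s); last by rewrite !mul0r.
by rewrite !inE eqxx /= subr0 !mul1r fsetD1K.
Qed.

Lemma pair_termE p (Psi : test Z -> R[i]^o) s :
  pair_term p Psi Psi s =
  (lambda s `^ (- (2 * p)) * normc (fock Psi s) ^+ 2)%:C%C.
Proof. by rewrite /pair_term -mulrA [_ * _^*%C]mulrC mulr_conj [RHS]rmorphM. Qed.

End number_operators.

Theorem theorem4p2 (R : realType) (d : measure_display) (T : measurableType d)
    (P : probability T R) (Z : normal_noise P)
    (chaoticZ : chaotic_representation Z)
    (p : R) (p_ge0 : 0 <= p)
    (Phi : test Z -> R[i]^o) (Phi_p : dual_p p Phi) :
  Var_defined p Phi /\
  exists v : R, Var p Phi = v%:C%C /\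
    (v%:E <= \sum_(0 <= k <oo) dual_norm p (creat k (annih k Phi)) ^+ 2)%E.
Proof.
have Phi_lty := dual_p_lty Phi_p.
pose Psi : test Z -> R[i]^o := Phi - expect Phi.
have centered s : fock Psi s = (s != fset0)%:R * fock Phi s.
  transitivity (fock Phi s - fock (expect Phi) s); first by [].
  rewrite (expectE _ p_ge0)//.
  by case: (s == fset0); rewrite ?mul1r ?mul0r ?subrr ?subr0.
have W_lty : (wnorm2 (- (2 * p)) (fock Psi) < +oo)%E.
  rewrite (funext centered); apply: le_lt_trans Phi_lty.
  exact: (wnorm2_mask _ (fun s => s != fset0)).
split.
  rewrite /Var_defined /Cov_defined /pair_defined -/Psi; apply: le_lt_trans W_lty.
  apply: le_esum => s _; rewrite pair_termE normc_real ger0_norm//.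
  exact: wnorm2_term_ge0.
(* The terms of the pairing are nonnegative reals with a finite sum, so the complex sum is this real
   number. *)
exists (fine (wnorm2 (- (2 * p)) (fock Psi))); split.
  rewrite /Var /Cov /pair -/Psi.
  rewrite (funext (pair_termE p _)).
  by apply: sum_ge0E => // s; exact: wnorm2_term_ge0.
rewrite fineK ?ge0_fin_numE ?wnorm2_ge0// (funext centered).
(* It remains to compare, for each [k], the part of the sum over the [s] containing [k] with the
   squared dual norm of the functional having that masked Fock transform. *)
apply: le_trans (wnorm2_nonempty_le _ _) _.
apply: lee_nneseries => [k _ _|k _]; first exact: wnorm2_ge0.
rewrite (creat_annihE _ p_ge0)//; apply: wnorm2_le_dual_norm => //.
by apply: le_lt_trans Phi_lty; exact: (wnorm2_mask _ (fun s => k \in s)).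
Qed.
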